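(* Fix $V_{\sf P}\ge 0$ and $\delta\in[0,1)$. There exists $p_0=p_0(\delta,V_{\sf P})\in(0,1]$ such that for every $p\in(0,p_0]$ (with $p<1$), the policy ${\sf APP}$ maximizes ${\sf Eng}(\pi)$ over all online policies $\pi$. Moreover, $$ {\sf Eng}({\sf APP})=\frac{1}{1-\delta}\cdot\frac{2e^{V_{\sf P}}}{1+2e^{V_{\sf P}}},\qquad {\sf Util}({\sf APP})=\frac{1}{1-\delta}\ln\!\left(1+2e^{V_{\sf P}}\right).$$
   Context: Model. Time $t=0,1,2,\dots$, discount factor $\delta\in[0,1)$. There are two item types, popular ${\sf P}$ and niche ${\sf N}$, each with infinitely many items. At each time $t$ the platform recommends a set $\pi_t$ of two items, each of which is a fresh (never previously recommended) item of a chosen type; so effectively it chooses one of the type pairs $\{{\sf P},{\sf P}\}$, $\{{\sf P},{\sf N}\}$, $\{{\sf N},{\sf N}\}$. The user's utility for an item $i$ of type $\tau(i)$ is $u_i=V_{\tau(i)}+\epsilon_i$, and for the outside option $\emptyset$ it is $u_\emptyset=\epsilon_\emptyset$ (base utility $0$). All noise terms $\epsilon$ (across items, the outside option, and time) are i.i.d. Gumbel with scale $1$ and mean $0$, i.e. CDF $x\mapsto\exp(-\exp(-(x+\gamma)))$ with $\gamma$ the Euler–Mascheroni constant. At each time the user chooses $c_t=\arg\max_{j\in\pi_t\cup\{\emptyset\}}u_j$. The popular base utility $V_{\sf P}$ is a known constant. The niche base utility $V_{\sf N}$ is a random variable drawn once (for the user, fixed over time, independent of the noise) with $\mathbb P(V_{\sf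 N}=(1-p)/p)=p$ and $\mathbb P(V_{\sf N}=-1)=1-p$, where $p\in(0,1)$; this distribution is known to the platform but the realization is not. An online policy is a (possibly randomized) rule choosing $\pi_t$ based only on the history $\{(\pi_s,c_s)\}_{s<t}$. For a policy $\pi$, ${\sf Eng}(\pi)=\sum_{t\ge0}\delta^t\,\mathbb P(c_t\ne\emptyset)$ and ${\sf Util}(\pi)=\sum_{t\ge0}\delta^t\,\mathbb E[\max_{j\in\pi_t\cup\{\emptyset\}}u_j]$, where expectations are also over $V_{\sf N}$. The Always Popular Policy ${\sf APP}$ recommends two popular items at every time $t$. *)

(* Defs.v *)
From HB Require Import structures.
From mathcomp Require Import all_boot all_order all_algebra.
From mathcomp Require Import all_classical all_reals all_analysis.
Set Implicit Arguments. Unset Strict Implicit. Unset Printing Implicit Defensive.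
Import Order.TTheory GRing.Theory Num.Theory.
Import numFieldNormedType.Exports.
Local Open Scope ring_scope.

Section Model.
Variable R : realType.

Definition euler_gamma : R :=
  limn (fun n : nat => (\sum_(0 <= k < n) (@harmonic R k)) - ln (n%:R)).

(* Density of the Gumbel law with scale 1 and mean 0, i.e. the derivative
   of the CDF x |-> exp(-exp(-(x+gamma))). *)
Definition gumbel_pdf (x : R) : R :=
  expR (- (x + euler_gamma)) * expR (- expR (- (x + euler_gamma))).

(* Expectation of F(e0,e1,e2) for three i.i.d. Gumbel noises
   (e0 = outside option, e1, e2 = the two recommended items),
   as an iterated Lebesgue integral against the product density. *)
Definition gumbelE3 (F : R -> R -> R -> R) : R :=
  fine (\int[@lebesgue_measure R]_e0
          ((gumbel_pdf e0)%:E *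
           \int[@lebesgue_measure R]_e1
             ((gumbel_pdf e1)%:E *
              \int[@lebesgue_measure R]_e2
                 ((gumbel_pdf e2 * F e0 e1 e2)%:E)))%E).

(* Item types: true = popular (P), false = niche (N).
   An action is the ordered pair of the types of the two (fresh) items
   recommended, in slots false (first) and true (second).
   An outcome is None (outside option) or Some slot (item chosen). *)
Definition action := (bool * bool)%type.
Definition outcome := option bool.
Definition entry := (action * outcome)%type.

Definition base_util (VP VN : R) (tau : bool) : R := if tau then VP else VN.

(* argmax over {outside, slot1, slot2}; ties (a null event) broken in
   favour of the outside option, then of the first slot. *)
Definition choose (u0 u1 u2 : R) : outcome :=
  if Num.max u1 u2 <= u0 then None
  else if u2 <= u1 then Some false else Some true.

Definition choice_prob (VP VN : R) (a : action) (o : outcome) : R :=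
  gumbelE3 (fun e0 e1 e2 =>
    if choose e0 (base_util VP VN a.1 + e1) (base_util VP VN a.2 + e2) == o
    then 1 else 0).

Definition exp_max_util (VP VN : R) (a : action) : R :=
  gumbelE3 (fun e0 e1 e2 =>
    Num.max e0 (Num.max (base_util VP VN a.1 + e1) (base_util VP VN a.2 + e2))).

(* An online (behaviourally randomized) policy: a distribution over actions
   for every history of past (action, outcome) pairs. *)
Definition policy := seq entry -> action -> R.

Definition is_policy (pol : policy) : Prop :=
  (forall h a, 0 <= pol h a) /\ (forall h, \sum_(a : action) pol h a = 1).

Definition entry0 : entry := ((true, true), None).

Definition hist_prob (VP VN : R) (pol : policy) (h : seq entry) : R :=
  \prod_(i < size h)
     (pol (take i h) (nth entry0 h i).1 *
      choice_prob VP VN (nth entry0 h i).1 (nth entry0 h i).2).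

Definition step_eng (VP VN : R) (pol : policy) (t : nat) : R :=
  \sum_(h : t.-tuple entry) hist_prob VP VN pol h *
     \sum_(a : action) pol h a * (1 - choice_prob VP VN a None).

Definition step_util (VP VN : R) (pol : policy) (t : nat) : R :=
  \sum_(h : t.-tuple entry) hist_prob VP VN pol h *
     \sum_(a : action) pol h a * exp_max_util VP VN a.

(* Distribution of V_N: (1-p)/p w.p. p, and -1 w.p. 1-p. *)
Definition step_eng_p (VP p : R) (pol : policy) (t : nat) : R :=
  p * step_eng VP ((1 - p) / p) pol t + (1 - p) * step_eng VP (-1) pol t.

Definition step_util_p (VP p : R) (pol : policy) (t : nat) : R :=
  p * step_util VP ((1 - p) / p) pol t + (1 - p) * step_util VP (-1) pol t.

Definition Eng (VP delta p : R) (pol : policy) : R :=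
  limn (fun n : nat => \sum_(0 <= t < n) delta ^+ t * step_eng_p VP p pol t).

Definition Util (VP delta p : R) (pol : policy) : R :=
  limn (fun n : nat => \sum_(0 <= t < n) delta ^+ t * step_util_p VP p pol t).

Definition APP : policy := fun _ a => if a == (true, true) then 1 else 0.

End Model.

(* Main.v *)
Require Import Defs.
From HB Require Import structures.
From mathcomp Require Import all_boot all_order all_algebra.
From mathcomp Require Import all_classical all_reals all_analysis.
From mathcomp Require Import measurable_realfun ring lra.
Set Implicit Arguments. Unset Strict Implicit. Unset Printing Implicit Defensive.
Import Order.TTheory GRing.Theory Num.Theory.
Import numFieldNormedType.Exports.
Local Open Scope ring_scope.
Local Open Scope classical_set_scope.

(** Compare a policy with APP through the first time it shows a niche item.
    Until then the history has the same law for both values of V_N, since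
    popular items reveal nothing.  A high-utility user gains at most 1 per period
    from that time on, a low-utility user loses at least a fixed gap in that
    very period; writing B_t for the probability of having deviated before time
    t, summation by parts turns this into a comparison of p with
    (1 - p) * gap * (1 - delta), uniformly over policies.

    The values for APP come from iterating one-dimensional integrals.  With G the
    Gumbel cdf and P its primitive vanishing at -oo, the max of independent
    shifted Gumbel variables only ever produces G (x - c) and P (x - c), because
    G (x - a) * G (x - b) = G (x - ln (e^a + e^b)).  That the law has mean 0 is
    the statement P x - x --> 0 at +oo; since P x = x + Ein (e^-(x + gamma)), it
    amounts to Ein t - ln t --> gamma, which follows from the bounds
    0 <= H_n - Ein n <= 1 / n on harmonic numbers. *)

(** * Monotonicity from the sign of the derivative *)

Lemma ge0_is_derive_le {R : realType} (F f : R -> R) (a b : R) : a <= b ->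
  (forall x, a <= x <= b -> is_derive x 1 F (f x)) ->
  (forall x, a < x < b -> 0 <= f x) -> F a <= F b.
Proof.
rewrite le_eqVlt => /predU1P[->//|ab] dF f0.
have cF : {within `[a, b], continuous F}.
  apply: derivable_within_continuous => x xab.
  have abx : a <= x <= b by move: xab; rewrite in_itv.
  exact: (@ex_derive _ _ _ _ _ _ _ (dF x abx)).
have dF' x : x \in `]a, b[%R -> is_derive x 1 F (f x).
  by rewrite in_itv/= => /andP[ax xb]; apply: dF; rewrite !ltW.
have [c cab FE] := MVT ab dF' cF.
by rewrite -subr_ge0 FE mulr_ge0 ?subr_ge0 ?(ltW ab)// f0.
Qed.

(** * The exponential integral and Euler's constant *)

Definition ein_density {R : realType} (s : R) : R := (1 - expR (- s)) / s.

(** The entire exponential integral. The interval leaves out 0, where the integrand has a removable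
    singularity. *)
Definition Ein {R : realType} (t : R) : R :=
  \int[lebesgue_measure]_(s in `]0, t]) ein_density s.

Lemma ein_density_itv {R : realType} (s : R) :
  0 < s -> 0 <= ein_density s <= 1.
Proof.
move=> s0; rewrite /ein_density; apply/andP; split.
  by rewrite divr_ge0 ?(ltW s0)// subr_ge0 expR_le1 oppr_le0 ltW.
rewrite ler_pdivrMr// mul1r; have := expR_ge1Dx (- s); lra.
Qed.

Lemma continuous_ein_density {R : realType} (s : R) : 0 < s ->
  {for s, continuous (@ein_density R)}.
Proof.
move=> s0; apply: cvgM; last by apply: cvgV; [rewrite gt_eqF|exact: cvg_id].
apply: cvgB; first exact: cvg_cst.
by apply: continuous_comp; [apply: cvgN; exact: cvg_id|exact: continuous_expR].
Qed.

Lemma integrable_ein_density {R : realType} (t : R) :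
  lebesgue_measure.-integrable `]0, t] (EFin \o @ein_density R).
Proof.
have [t0|t0] := leP t 0.
  by rewrite set_itv_ge ?bnd_simp -?leNgt//; exact: integrable_set0.
apply: measurable_bounded_integrable => //.
- by rewrite /= lebesgue_measure_itv/= lte_fin t0 ltry.
- apply: (@measurable_funS _ _ _ _ (`]0, +oo[ : set R)) => //.
    by move=> x/=; rewrite !in_itv/= andbT => /andP[].
  apply: open_continuous_measurable_fun => // x; rewrite inE/= in_itv/= andbT.
  exact: continuous_ein_density.
- exists 1; split; first exact: num_real.
  move=> M M1 s/=; rewrite in_itv/= => /andP[s0 _].
  have /andP[d0 d1] := ein_density_itv s0.
  by rewrite ger0_norm// (le_trans d1)// ltW.
Qed.

Lemma is_derive_Ein {R : realType} (t : R) : 0 < t ->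
  is_derive t 1 (@Ein R) (ein_density t).
Proof.
move=> t0.
(* Integrating up to [t + 1] makes [t] an interior point, as the fundamental theorem requires. *)
have tt1 : t < t + 1 by rewrite ltrDl.
have [|d1 d2] := continuous_FTC1 tt1 (integrable_ein_density (t + 1)) _
  (continuous_ein_density t0).
  by [].
by rewrite -d2 derive1E; exact/derivableP.
Qed.

Lemma Ein_itv {R : realType} (t : R) : 0 < t -> 0 <= @Ein R t <= t.
Proof.
move=> t0; apply/andP; split.
  apply: Rintegral_ge0 => s/=; rewrite in_itv/= => /andP[s0 _].
  by case/andP: (ein_density_itv s0).
have : \int[lebesgue_measure]_(s in `]0, t]) (cst 1 s : R) = t.
  rewrite Rintegral_cst// /= lebesgue_measure_itv/= lte_fin t0/= mul1r.
  by rewrite subr0.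
move=> {2}<-; apply: le_Rintegral => //.
- exact: integrable_ein_density.
- apply/integrableP; split; first exact: measurableT_comp.
  under eq_integral do rewrite /= normr1.
  by rewrite integral_cst// /= lebesgue_measure_itv/= lte_fin t0 mul1e ltry.
- move=> s/=; rewrite in_itv/= => /andP[s0 _].
  by case/andP: (ein_density_itv s0).
Qed.

(** These rules are stated for functions written as [fun y => ...], the form in which [derive_eq]
    meets its goals. *)
Lemma is_deriveDf {R : realType} (f g : R -> R) (x a b : R) :
  is_derive x 1 f a -> is_derive x 1 g b ->
  is_derive x 1 (fun y => f y + g y) (a + b).
Proof. exact: is_deriveD. Qed.

Lemma is_deriveNf {R : realType} (f : R -> R) (x a : R) :
  is_derive x 1 f a -> is_derive x 1 (fun y => - f y) (- a).
Proof. exact: is_deriveN. Qed.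

Lemma is_deriveMf {R : realType} (f g : R -> R) (x a b : R) :
  is_derive x 1 f a -> is_derive x 1 g b ->
  is_derive x 1 (fun y => f y * g y) (f x * b + g x * a).
Proof. exact: is_deriveM. Qed.

Lemma is_deriveXf {R : realType} (f : R -> R) n (x a : R) :
  is_derive x 1 f a ->
  is_derive x 1 (fun y => f y ^+ n.+1) (n.+1%:R * f x ^+ n * a).
Proof.
move=> df; elim: n => [|n IH].
  by apply: (is_derive_eq df); rewrite expr0 !mul1r.
rewrite (_ : (fun y => _) = (fun y => f y * f y ^+ n.+1)).
  apply: (is_derive_eq (is_deriveMf df IH)).
  by rewrite -[n.+2%:R]natr1 !exprS; ring.
by apply/funext => y; rewrite -exprS.
Qed.

Lemma is_derive_compf {R : realType} (f g : R -> R) (x a b : R) :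
  is_derive (f x) 1 g b -> is_derive x 1 f a ->
  is_derive x 1 (fun y => g (f y)) (b * a).
Proof. exact: is_derive1_comp. Qed.

Lemma is_derive_expRf {R : realType} (f : R -> R) (x a : R) :
  is_derive x 1 f a -> is_derive x 1 (fun y => expR (f y)) (expR (f x) * a).
Proof. by apply: is_derive_compf; exact: is_derive_expR. Qed.

Lemma is_derive_cstf {R : realType} (c x : R) : is_derive x 1 (fun=> c : R) 0.
Proof. exact: is_derive_cst. Qed.

Lemma is_derive_idf {R : realType} (x : R) : is_derive x 1 (fun y : R => y) 1.
Proof. exact: is_derive_id. Qed.

Lemma is_derive_sumf {R : realType} n (f : 'I_n -> R -> R) (x : R) a :
  (forall i, is_derive x 1 (f i) (a i)) ->
  is_derive x 1 (fun y => \sum_(i < n) f i y) (\sum_(i < n) a i).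
Proof.
move=> df; rewrite (_ : (fun y => _) = \sum_(i < n) f i); first exact: is_derive_sum.
by apply/funext => y; rewrite fct_sumE.
Qed.

(* [notypeclasses refine], since [apply:] would let instance resolution choose
   the derivative. *)
Ltac derive_eq := notypeclasses refine (is_derive_eq _ _);
  [repeat first
    [ exact: is_derive_idf | exact: is_derive_cstf | eassumption
    | notypeclasses refine (is_deriveDf _ _)
    | notypeclasses refine (is_deriveNf _)
    | notypeclasses refine (is_deriveXf _ _)
    | notypeclasses refine (is_deriveMf _ _)
    | notypeclasses refine (is_derive_expRf _)
    | notypeclasses refine (is_derive_sumf _) => ? ] | rewrite ?/=].

(** * Harmonic numbers and the exponential integral *)

Lemma bernoulli {R : realType} (x : R) n : -1 <= x -> 1 + n%:R * x <= (1 + x) ^+ n.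
Proof.
move=> x1; elim: n => [|n IH]; first by rewrite mul0r addr0 expr0.
have n0 : 0 <= n%:R :> R by [].
(* The two sides of the first inequality differ by [n%:R * x ^+ 2]. *)
rewrite exprS; apply: (@le_trans _ _ ((1 + x) * (1 + n%:R * x))).
  rewrite -natr1; nra.
by rewrite ler_wpM2l//; lra.
Qed.

(** Put [u = t / n]. The upper bound is the n-th power of [1 - u <= expR (- u)]. For the lower one,
    [1 + u <= expR u] gives [(1 - u) ^+ n * expR t >= (1 - u ^+ 2) ^+ n], and Bernoulli bounds this
    below by [1 - n u^2 = 1 - t^2 / n]. *)
Lemma expR_pow_itv {R : realType} (t : R) n : (0 < n)%N -> 0 <= t <= n%:R ->
  (1 - t ^+ 2 / n%:R) * expR (- t) <= (1 - t / n%:R) ^+ n <= expR (- t).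
Proof.
move=> n0 /andP[t0 tn]; have n0' : 0 < n%:R :> R by rewrite ltr0n.
have u1 : t / n%:R <= 1 by rewrite ler_pdivrMr// mul1r.
have u0 : 0 <= t / n%:R by rewrite divr_ge0.
have tE : t = n%:R * (t / n%:R) by rewrite mulrC divfK// gt_eqF.
move: (t / n%:R) u1 u0 tE => u u1 u0 tE.
apply/andP; split; last first.
  rewrite tE -mulrN expRM_natl lerXn2r ?nnegrE ?expR_ge0 ?subr_ge0//.
  exact: expR_ge1Dx.
rewrite expRN ler_pdivrMr ?expR_gt0//.
apply: (@le_trans _ _ ((1 - u) ^+ n * (1 + u) ^+ n)); last first.
  rewrite ler_wpM2l ?exprn_ge0 ?subr_ge0// tE expRM_natl.
  by rewrite lerXn2r ?nnegrE ?expR_ge0 ?addr_ge0// expR_ge1Dx.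
rewrite -exprMn (_ : (1 - u) * (1 + u) = 1 + - u ^+ 2); last by ring.
have -> : 1 - t ^+ 2 / n%:R = 1 + n%:R * (- u ^+ 2).
  by rewrite {1}tE; field; rewrite gt_eqF.
by apply: bernoulli; nra.
Qed.

(* By the geometric sum its derivative is [(1 - (1 - t/n)^n) / t], the n-th
   approximation of the integrand of [Ein], and its value at [n] is the n-th
   harmonic number. *)
Definition Ein_approx {R : realType} (n : nat) (t : R) : R :=
  \sum_(k < n) (1 - (1 - t / n%:R) ^+ k.+1) / k.+1%:R.

Lemma Ein_approx_n {R : realType} n : (0 < n)%N ->
  Ein_approx n n%:R = \sum_(0 <= k < n) harmonic k :> R.
Proof.
move=> n0; rewrite big_mkord; apply: eq_bigr => k _.
by rewrite divff ?pnatr_eq0 -?lt0n// subrr expr0n/= subr0 div1r.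
Qed.

(** By Bernoulli each of the n terms is at most [t / n]. Together with [Ein_itv] this makes the
    difference of the two functions negligible near 0. *)
Lemma Ein_approx_itv {R : realType} n (t : R) : (0 < n)%N -> 0 <= t <= n%:R ->
  0 <= Ein_approx n t <= t.
Proof.
move=> n0 /andP[t0 tn]; have n0' : 0 < n%:R :> R by rewrite ltr0n.
have u1 : t / n%:R <= 1 by rewrite ler_pdivrMr// mul1r.
have u0 : 0 <= t / n%:R by rewrite divr_ge0.
apply/andP; split.
  apply: sumr_ge0 => k _; rewrite divr_ge0// subr_ge0 exprn_ile1 ?subr_ge0//.
  by rewrite gerBl.
apply: (@le_trans _ _ (\sum_(k < n) t / n%:R)); last first.
  by rewrite sumr_const card_ord -[_ *+ _]mulr_natr divfK// gt_eqF.
apply: ler_sum => k _; rewrite ler_pdivrMr ?ltr0n//.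
have := @bernoulli _ (- (t / n%:R)) k.+1; rewrite mulrN; lra.
Qed.

Lemma is_derive_Ein_approx {R : realType} n (t : R) : (0 < n)%N -> 0 < t ->
  is_derive t 1 (Ein_approx n) ((1 - (1 - t / n%:R) ^+ n) / t).
Proof.
move=> n0 t0; have n0' : 0 < n%:R :> R by rewrite ltr0n.
derive_eq.
transitivity (\sum_(i < n) (1 - t / n%:R) ^+ i / n%:R).
  apply: eq_bigr => i _ /=; field; rewrite gt_eqF//=.
rewrite -mulr_suml.
have := subrX1 (1 - t / n%:R) n.
move=> /(congr1 (fun x => - x / t)); rewrite opprB => ->.
by field; rewrite !gt_eqF.
Qed.

(** The difference is the integral over []0, n]] of [(expR (- x) - (1 - x / n) ^+ n) / x]. By
    [expR_pow_itv] this integrand lies between 0 and [x * expR (- x) / n], and the latter has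
    integral at most [1 / n]. *)
Lemma harmonic_sub_Ein {R : realType} n : (0 < n)%N ->
  0 <= \sum_(0 <= k < n) harmonic k - @Ein R n%:R <= n%:R^-1.
Proof.
move=> n0; have n0' : 0 < n%:R :> R by rewrite ltr0n.
rewrite -Ein_approx_n//.
have D s t : 0 < s <= t -> t <= n%:R ->
    forall x : R, s <= x <= t -> is_derive x 1 (fun x => Ein_approx n x - Ein x)
    ((expR (- x) - (1 - x / n%:R) ^+ n) / x).
  move=> /andP[s0 _] _ x /andP[sx _]; have x0 := lt_le_trans s0 sx.
  have ? := is_derive_Ein_approx n0 x0; have ? := is_derive_Ein x0.
  derive_eq.
  by rewrite /ein_density; field; rewrite gt_eqF.
apply/andP; split; apply/ler_addgt0Pr => e e0.
(* The derivatives are available only for positive arguments, so the comparison starts at [s], where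
   both functions lie between 0 and [e]. *)
- pose s := Num.min e n%:R.
  have s0 : 0 < s by rewrite lt_min e0.
  have sn : s <= n%:R by rewrite ge_min lexx orbT.
  have se : s <= e by rewrite ge_min lexx.
  have /andP[q0 q1] := Ein_itv s0.
  have /andP[a0 a1] := @Ein_approx_itv R n s n0 ltac:(by rewrite ltW).
  suff : Ein_approx n s - Ein s <= Ein_approx n n%:R - Ein n%:R by lra.
  apply: (ge0_is_derive_le sn (D s _ _ _)); rewrite ?s0//.
  move=> x /andP[sx xn]; have x0 := lt_trans s0 sx.
  rewrite divr_ge0 ?(ltW x0)// subr_ge0.
  by have /andP[] := @expR_pow_itv R x n n0 ltac:(by rewrite !ltW).
- pose s := Num.min e n%:R.
  have s0 : 0 < s by rewrite lt_min e0.
  have sn : s <= n%:R by rewrite ge_min lexx orbT.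
  have se : s <= e by rewrite ge_min lexx.
  have /andP[q0 q1] := Ein_itv s0.
  have /andP[a0 a1] := @Ein_approx_itv R n s n0 ltac:(by rewrite ltW).
  (* [- E] is a primitive of [x * expR (- x) / n], and [E] decreases from the value [1 / n] at 0. *)
  pose E (x : R) := n%:R^-1 * ((x + 1) * expR (- x)).
  have E0 x : 0 <= x -> 0 <= E x.
    by move=> x0; rewrite !mulr_ge0 ?expR_ge0 ?addr_ge0.
  have E1 : E s <= n%:R^-1.
    rewrite ler_piMr// expRN ler_pdivrMr ?expR_gt0// mul1r addrC.
    exact: expR_ge1Dx.
  suff : - (Ein_approx n s - Ein s) - E s
     <= - (Ein_approx n n%:R - Ein n%:R) - E n%:R by have := E0 n%:R; lra.
  apply: (@ge0_is_derive_le _ (fun x => - (Ein_approx n x - Ein x) - E x)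
    (fun x => x * expR (- x) / n%:R - (expR (- x) - (1 - x / n%:R) ^+ n) / x)) => //.
    move=> x sxn; have ssn : 0 < s <= n%:R by rewrite s0.
    have dD := D s n%:R ssn (lexx _) x sxn.
    have dE : is_derive x 1 (fun x => expR (- x) : R) (- expR (- x)).
      by derive_eq; ring.
    by derive_eq; ring.
  move=> x /andP[sx xn]; have x0 := lt_trans s0 sx.
  have /andP[h _] := @expR_pow_itv R x n n0 ltac:(by rewrite !ltW).
  rewrite subr_ge0 ler_pdivrMr//.
  by move: h; rewrite -[_ * x]mulrA; lra.
Qed.

Lemma continuous_is_derive {R : realType} (F f : R -> R) :
  (forall x : R, is_derive x 1 F (f x)) -> continuous F.
Proof.
move=> dF x; apply: differentiable_continuous; apply/derivable1_diffP.
exact: (@ex_derive _ _ _ _ _ _ _ (dF x)).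
Qed.

(** The chain rule cancels the denominator of [ein_density]. What remains is the Gumbel cdf before
    centring. *)
Lemma is_derive_addr_Ein_expRN {R : realType} (x : R) :
  is_derive x 1 (fun y => y + Ein (expR (- y))) (expR (- expR (- x))).
Proof.
have d1 : is_derive x 1 (fun y => expR (- y) : R) (- expR (- x)).
  by derive_eq; ring.
have d2 := @is_derive_compf _ (fun y => expR (- y)) _ _ _ _
    (is_derive_Ein (expR_gt0 (- x))) d1.
derive_eq; rewrite /ein_density; field.
by rewrite gt_eqF// expR_gt0.
Qed.

(** Only existence of the limit: [v] is nondecreasing and bounded below, so it converges at -oo. The
    value is identified afterwards along the integers. *)
Lemma cvgr_addN_Ein {R : realType} :
  exists l : R, - x + Ein (expR x) @[x --> +oo] --> l.
Proof.
pose v (x : R) := x + Ein (expR (- x)).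
have vE x : - x + Ein (expR x) = v (- x) by rewrite /v opprK.
have v_incr x y : x <= y -> v x <= v y.
  move=> xy; apply: (ge0_is_derive_le xy (fun z _ => is_derive_addr_Ein_expRN z)).
  by move=> *; exact: expR_ge0.
have v_lb x : v 0 - 1 <= v x.
  have [x0|x0] := leP 0 x; first by rewrite lerBlDr (le_trans (v_incr _ _ x0))// lerDl.
  (* On the negative half-line [v x - expR (- expR (- x))] is nonincreasing, and the subtracted
     exponential stays in [[0, 1]]. *)
  have : - (v x - expR (- expR (- x))) <= - (v 0 - expR (- expR (- 0))).
    apply: (@ge0_is_derive_le _ (fun x => - (v x - expR (- expR (- x))))
      (fun x => expR (- expR (- x)) * (expR (- x) - 1)) _ _ (ltW x0)).
      move=> z _; have dv := is_derive_addr_Ein_expRN z.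
      rewrite -/v in dv.
      by derive_eq; ring.
    move=> z /andP[_ z0]; rewrite mulr_ge0 ?expR_ge0// subr_ge0.
    have := expR_ge1Dx (- z); lra.
  have := expR_ge0 (- expR (- x)).
  have : expR (- expR (- 0)) <= 1 :> R by rewrite expR_le1 oppr_le0 expR_ge0.
  move: (v x) (v 0) (expR _) (expR _) => a b c d; lra.
exists (- sup (range (fun x => - v (- x)))).
rewrite (_ : (fun x => _) = (fun x => - (- v (- x)))); last first.
  by apply/funext => x; rewrite opprK vE.
apply: cvgN; apply: nondecreasing_cvgr.
  by move=> x y xy; rewrite lerN2 v_incr// lerN2.
by exists (- (v 0 - 1)) => _ [x _ <-]; rewrite lerN2.
Qed.

(** Along [x = ln n] the limit [l] is that of [Ein n - ln n]. Adding [H_n - Ein n], squeezed between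
    0 and [1 / n], gives the sequence that defines [euler_gamma]; so that sequence converges, and to
    [l]. *)
Lemma cvgr_euler_gamma {R : realType} :
  - x + Ein (expR x) @[x --> +oo] --> euler_gamma R.
Proof.
have [l vl] := @cvgr_addN_Ein R.
suff -> : euler_gamma R = l by [].
have lny : ln (n%:R : R) @[n --> \oo] --> +oo.
  apply/cvgryPge => A; near=> n.
  have An : expR A <= n%:R by near: n; exact: nbhs_infty_ger.
  have n0 : 0 < n%:R :> R by rewrite (lt_le_trans _ An)// expR_gt0.
  by rewrite -ler_expR lnK// posrE.
have Einl : - ln n%:R + Ein n%:R @[n --> \oo] --> l.
  have := (cvg_pinftyP _ _).1 vl _ lny.
  apply: cvg_trans; apply: near_eq_cvg; near=> n.
  have n0 : (0 < n)%N by near: n; exact: nbhs_infty_gt.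
  by rewrite lnK// posrE ltr0n.
apply/cvg_lim => //.
rewrite -[l]add0r.
rewrite (_ : (fun n => _) = (fun n : nat =>
   (\sum_(0 <= k < n) harmonic k - Ein n%:R) + (- ln n%:R + Ein n%:R))); last first.
  by apply/funext => n; ring.
apply: cvgD => //.
apply: (@squeeze_cvgr _ _ _ _ (fun=> 0) (fun n : nat => n%:R^-1)).
- near=> n; apply: harmonic_sub_Ein.
  by near: n; exact: nbhs_infty_gt.
- exact: cvg_cst.
- by rewrite -cvg_shiftS; exact: cvg_harmonic.
Unshelve. all: by end_near. Qed.

(** * The Gumbel distribution *)

Definition gumbel_cdf {R : realType} (x : R) : R :=
  expR (- expR (- (x + euler_gamma R))).

(* The primitive of the Gumbel cdf that vanishes at -oo: that this one also
   satisfies [gumbel_prim x - x --> 0] at +oo says that the law has mean 0. *)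
Definition gumbel_prim {R : realType} (x : R) : R :=
  x + Ein (expR (- (x + euler_gamma R))).

Lemma is_derive_gumbel_cdf {R : realType} (x : R) :
  is_derive x 1 gumbel_cdf (gumbel_pdf x).
Proof. by rewrite /gumbel_cdf; derive_eq; rewrite /gumbel_pdf; ring. Qed.

Lemma is_derive_gumbel_prim {R : realType} (x : R) :
  is_derive x 1 gumbel_prim (gumbel_cdf x).
Proof.
have d1 : is_derive x 1 (fun y => y + euler_gamma R) 1 by derive_eq; ring.
have d2 := @is_derive_compf _ (fun y => y + euler_gamma R) _ _ _ _
    (is_derive_addr_Ein_expRN (x + euler_gamma R)) d1.
rewrite (_ : gumbel_prim = fun y =>
  y + euler_gamma R + Ein (expR (- (y + euler_gamma R))) + - euler_gamma R).
  by derive_eq; rewrite addr0 mulr1.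
by apply/funext => y; rewrite /gumbel_prim; ring.
Qed.

Lemma gumbel_cdf_gt0 {R : realType} (x : R) : 0 < gumbel_cdf x.
Proof. exact: expR_gt0. Qed.

Lemma gumbel_pdf_gt0 {R : realType} (x : R) : 0 < gumbel_pdf x.
Proof. by rewrite mulr_gt0// expR_gt0. Qed.

Lemma gumbel_cdf_le1 {R : realType} (x : R) : gumbel_cdf x <= 1.
Proof. by rewrite expR_le1 oppr_le0 expR_ge0. Qed.

(** Substituting [- (x + gamma)] reduces this to [cvgr_euler_gamma]. With another constant in place
    of gamma the limit would not be 0, so the centring of the noise enters here. *)
Lemma cvgNy_gumbel_prim {R : realType} :
  @gumbel_prim R x @[x --> -oo] --> (0 : R).
Proof.
have yNx : - (x + euler_gamma R) @[x --> -oo] --> +oo.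
  apply/cvgryPge => A; near=> x.
  rewrite lerNr -lerBrDr; near: x.
  by apply: nbhs_ninfty_le; rewrite num_real.
have h : - x + Ein (expR x) - euler_gamma R @[x --> +oo] --> (0 : R).
  have := cvgB (@cvgr_euler_gamma R) (cvg_cst (euler_gamma R)).
  by rewrite subrr; apply.
rewrite (_ : gumbel_prim = (fun x => - x + Ein (expR x) - euler_gamma R) \o
    (fun x => - (x + euler_gamma R))); first exact: cvg_comp yNx h.
by apply/funext => x; rewrite /gumbel_prim /=; ring.
Unshelve. all: by end_near. Qed.

Lemma cvgy_expRN_shift {R : realType} (c : R) :
  expR (- (x + c)) @[x --> +oo] --> (0 : R).
Proof.
rewrite (_ : (fun x => _) = (fun x => expR (- c) * expR (- x))); last first.
  by apply/funext => x; rewrite opprD expRD mulrC.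
have := cvgM (cvg_cst (expR (- c))) (@cvgr_expR R).
by rewrite mulr0; apply.
Qed.

Lemma cvgy_gumbel_prim {R : realType} :
  @gumbel_prim R x - x @[x --> +oo] --> (0 : R).
Proof.
rewrite (_ : (fun x => _) = fun x => Ein (expR (- (x + euler_gamma R)))).
  apply: squeeze_cvgr; last exact: (cvgy_expRN_shift (euler_gamma R)).
    by apply: nearW => x; apply: Ein_itv; exact: expR_gt0.
  exact: cvg_cst.
by apply/funext => x; rewrite /gumbel_prim; ring.
Qed.

(** It increases from its limit 0 at -oo. This provides the nonnegativity that the integration
    lemmas ask for. *)
Lemma gumbel_prim_ge0 {R : realType} (x : R) : 0 <= gumbel_prim x.
Proof.
have incr (y : R) : y <= x -> gumbel_prim y <= gumbel_prim x.
  move=> yx; apply: (ge0_is_derive_le yx (fun z _ => is_derive_gumbel_prim z)).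
  by move=> z _; rewrite ltW// gumbel_cdf_gt0.
rewrite -(cvg_lim (@Rhausdorff R) cvgNy_gumbel_prim).
apply: limr_le; first by apply/cvg_ex; exists 0; exact: cvgNy_gumbel_prim.
near=> y; apply: incr; near: y.
by apply: nbhs_ninfty_le; rewrite num_real.
Unshelve. all: by end_near. Qed.

(** * Integration over the real line by primitives *)

Lemma ge0_integral_bndy {R : realType} (F f : R -> R) (b l : R) :
  (forall x : R, b <= x -> 0 <= f x) -> continuous f ->
  (forall x : R, is_derive x 1 F (f x)) -> F x @[x --> +oo] --> l ->
  (\int[lebesgue_measure]_(x in `[b, +oo[) (f x)%:E)%E = (l - F b)%:E.
Proof.
move=> f0 cf dF Fl; rewrite EFinB; apply: ge0_continuous_FTC2y => //.
- exact: continuous_subspaceT.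
- by apply: cvg_at_right_filter; apply: (continuous_is_derive dF).
- by move=> x _; rewrite derive1E; exact: derive_val.
Qed.

Lemma ge0_integral_Nybnd {R : realType} (F f : R -> R) (b l : R) :
  (forall x : R, x <= b -> 0 <= f x) -> continuous f ->
  (forall x : R, is_derive x 1 F (f x)) -> F x @[x --> -oo] --> l ->
  (\int[lebesgue_measure]_(x in `]-oo, b]) (f x)%:E)%E = (F b - l)%:E.
Proof.
move=> f0 cf dF Fl.
have dG (x : R) : is_derive x 1 (fun y => - F (- y)) ((f \o -%R) x).
  (* The reflection [x |-> - x] carries this half-line to the one already treated. *)
  have dN : is_derive x 1 (fun y => - y) (- 1 : R) by derive_eq.
  have dFN := @is_derive_compf _ (fun y => - y) _ _ _ _ (dF (- x)) dN.
  by derive_eq; ring.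
rewrite -[b]opprK ge0_integration_by_substitutionNy.
- rewrite (ge0_integral_bndy (l := - l) _ _ dG).
  + by rewrite !opprK addrC.
  + by move=> x bx; rewrite /= f0// lerNl.
  + by move=> x; apply: continuous_comp; [exact: opp_continuous|exact: cf].
  + by apply: cvgN; exact/cvgNy_compNP.
- exact: continuous_subspaceT.
- by move=> x; rewrite in_itv/= opprK => /ltW; exact: f0.
Qed.

Lemma measurable_fun_cut {R : realType} (h h1 h2 : R -> R) (b : R) :
  (forall x, x <= b -> h x = h1 x) -> (forall x, b < x -> h x = h2 x) ->
  continuous h1 -> continuous h2 -> measurable_fun setT h.
Proof.
move=> hh1 hh2 c1 c2; rewrite -(itv_setU_setT false b).
apply/measurable_funU => //; split.
  apply: (eq_measurable_fun h1); first by move=> x; rewrite inE/= in_itv/= => /hh1.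
  by apply: measurable_funTS; exact: continuous_measurable_fun.
apply: (eq_measurable_fun h2).
  by move=> x; rewrite inE/= in_itv/= andbT => /hh2.
by apply: measurable_funTS; exact: continuous_measurable_fun.
Qed.

(** An argmax or a max changes its formula at a threshold [b], and each side has its own primitive.
    The point [b] is a null set, so its side does not affect the value. *)
Lemma ge0_integral_cut {R : realType} (h h1 h2 F1 F2 : R -> R) (b l1 l2 : R) :
  (forall x, x <= b -> h x = h1 x) -> (forall x, b < x -> h x = h2 x) ->
  (forall x, x <= b -> 0 <= h1 x) -> (forall x, b <= x -> 0 <= h2 x) ->
  continuous h1 -> continuous h2 ->
  (forall x : R, is_derive x 1 F1 (h1 x)) ->
  (forall x : R, is_derive x 1 F2 (h2 x)) ->
  F1 x @[x --> -oo] --> l1 -> F2 x @[x --> +oo] --> l2 ->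
  (\int[lebesgue_measure]_x (h x)%:E)%E = (F1 b - l1 + (l2 - F2 b))%:E.
Proof.
move=> hh1 hh2 h10 h20 c1 c2 d1 d2 Fl1 Fl2.
have mh := measurable_fun_cut hh1 hh2 c1 c2.
rewrite -(itv_setU_setT false b) ge0_integral_setU//=.
- rewrite EFinD; congr (_ + _)%E.
    rewrite -(ge0_integral_Nybnd h10 c1 d1 Fl1); apply: eq_integral => x.
    by rewrite inE/= in_itv/= => /hh1 ->.
  rewrite -(ge0_integral_bndy h20 c2 d2 Fl2) -integral_itv_obnd_cbnd; last first.
    by apply: measurable_funTS; apply/measurable_EFinP; exact: continuous_measurable_fun.
  apply: eq_integral => x.
  by rewrite inE/= in_itv/= andbT => /hh2 ->.
- by rewrite itv_setU_setT; apply/measurable_EFinP.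
- move=> x _; rewrite lee_fin; have [xb|bx] := leP x b.
    by rewrite hh1// h10.
  by rewrite hh2// h20// ltW.
- apply/disj_setPS => x [] /=; rewrite !in_itv/= andbT => xb.
  by rewrite ltNge xb.
Qed.

Lemma ge0_integrable {R : realType} (h : R -> R) (c : R) :
  measurable_fun setT h -> (forall x, 0 <= h x) ->
  (\int[lebesgue_measure]_x (h x)%:E)%E = c%:E ->
  lebesgue_measure.-integrable setT (EFin \o h).
Proof.
move=> mh h0 hc; apply/integrableP; split; first exact/measurable_EFinP.
under eq_integral do rewrite /= ger0_norm//.
by rewrite hc ltry.
Qed.

Lemma is_derive_subr {R : realType} (f : R -> R) (c x a : R) :
  is_derive (x - c) 1 f a -> is_derive x 1 (fun y => f (y - c)) a.
Proof.
move=> df; have dc : is_derive x 1 (fun y => y - c) 1 by derive_eq; ring.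
by rewrite -[a]mulr1; exact: (@is_derive_compf _ (fun y => y - c) _ _ _ _ df dc).
Qed.

(** The derivative of the density. It serves to obtain continuity of integrands from their
    differentiability. *)
Definition gumbel_pdf' {R : realType} (x : R) : R :=
  gumbel_pdf x * (expR (- (x + euler_gamma R)) - 1).

Lemma is_derive_gumbel_pdf {R : realType} (x : R) :
  is_derive x 1 (@gumbel_pdf R) (gumbel_pdf' x).
Proof.
rewrite /gumbel_pdf'.
rewrite (_ : @gumbel_pdf R = (fun y => expR (- (y + euler_gamma R)) * gumbel_cdf y)) //.
have := is_derive_gumbel_cdf x => ?.
derive_eq; rewrite /gumbel_pdf -/(gumbel_cdf x); ring.
Qed.

(** The rule is chosen by the syntactic form of the function, so that [gumbel_cdf], [gumbel_pdf] and
    [gumbel_prim] stay folded. *)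
Ltac gumbel_derive_step := match goal with
  | |- is_derive _ _ (fun y => y) _ => exact: is_derive_idf
  | |- is_derive _ _ (fun _ => ?c) _ => exact: is_derive_cstf
  | |- is_derive _ _ gumbel_cdf _ => exact: is_derive_gumbel_cdf
  | |- is_derive _ _ gumbel_pdf _ => exact: is_derive_gumbel_pdf
  | |- is_derive _ _ gumbel_prim _ => exact: is_derive_gumbel_prim
  | |- is_derive _ _ (fun y => gumbel_cdf y) _ => exact: is_derive_gumbel_cdf
  | |- is_derive _ _ (fun y => gumbel_pdf y) _ => exact: is_derive_gumbel_pdf
  | |- is_derive _ _ (fun y => gumbel_prim y) _ => exact: is_derive_gumbel_prim
  | |- is_derive _ _ (fun y => gumbel_cdf (y - _)) _ =>
      exact: (is_derive_subr (is_derive_gumbel_cdf _))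
  | |- is_derive _ _ (fun y => gumbel_prim (y - _)) _ =>
      exact: (is_derive_subr (is_derive_gumbel_prim _))
  | |- is_derive _ _ (fun y => @?f y + @?g y) _ =>
      notypeclasses refine (@is_deriveDf _ f g _ _ _ _ _)
  | |- is_derive _ _ (fun y => - @?f y) _ =>
      notypeclasses refine (@is_deriveNf _ f _ _ _)
  | |- is_derive _ _ (fun y => @?f y * @?g y) _ =>
      notypeclasses refine (@is_deriveMf _ f g _ _ _ _ _)
  end.

Ltac gumbel_derive_eq := notypeclasses refine (is_derive_eq _ _);
  [repeat gumbel_derive_step | rewrite ?/=].

Ltac gumbel_continuous := match goal with |- continuous ?f =>
  notypeclasses refine (@continuous_is_derive _ f _ _) => ?;
  gumbel_derive_eq; reflexivity end.

(** * Max-stability of the Gumbel law *)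

Lemma gumbel_pdfE {R : realType} (x : R) :
  gumbel_pdf x = expR (- (x + euler_gamma R)) * gumbel_cdf x.
Proof. by []. Qed.

(** The inner exponentials add up: the maximum of two shifted Gumbel variables is again a shifted
    Gumbel variable. *)
Lemma gumbel_cdfM {R : realType} (a b x : R) :
  gumbel_cdf (x - a) * gumbel_cdf (x - b) =
  gumbel_cdf (x - ln (expR a + expR b)).
Proof.
rewrite /gumbel_cdf -expRD; congr expR.
have E c : - (x - c + euler_gamma R) = c + - (x + euler_gamma R) by ring.
rewrite !E !expRD lnK ?posrE ?addr_gt0 ?expR_gt0//; ring.
Qed.

(** Write the density as [expR (- (x + gamma))] times the cdf and merge the two cdfs. Shifting the
    exponential along produces the factor [1 / (1 + expR c)], the source of every logit probability
    below. *)
Lemma gumbel_pdf_cdfM {R : realType} (c x : R) :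
  gumbel_pdf x * gumbel_cdf (x - c) =
  gumbel_pdf (x - ln (1 + expR c)) / (1 + expR c).
Proof.
rewrite !gumbel_pdfE -mulrA.
have := gumbel_cdfM 0 c x; rewrite subr0 expR0 => ->.
have c0 : 0 < 1 + expR c by rewrite addr_gt0 ?expR_gt0.
have -> : - (x - ln (1 + expR c) + euler_gamma R) =
  ln (1 + expR c) + - (x + euler_gamma R) by ring.
rewrite expRD lnK ?posrE//; field.
by rewrite gt_eqF.
Qed.

Lemma cvgy_subr {R : realType} (f : R -> R) (c l : R) :
  f x @[x --> +oo] --> l -> f (x - c) @[x --> +oo] --> l.
Proof.
move=> fl; apply: (@cvg_comp _ _ _ (fun x => x - c) f) fl.
apply/cvgryPge => A; near=> x; rewrite lerBrDr; near: x.
by apply: nbhs_pinfty_ge; rewrite num_real.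
Unshelve. all: by end_near. Qed.

Lemma cvgNy_subr {R : realType} (f : R -> R) (c l : R) :
  f x @[x --> -oo] --> l -> f (x - c) @[x --> -oo] --> l.
Proof.
move=> fl; apply: (@cvg_comp _ _ _ (fun x => x - c) f) fl.
apply/cvgrNyPle => A; near=> x; rewrite lerBlDr; near: x.
by apply: nbhs_ninfty_le; rewrite num_real.
Unshelve. all: by end_near. Qed.

Lemma cvgy_gumbel_cdf {R : realType} : @gumbel_cdf R x @[x --> +oo] --> (1 : R).
Proof.
suff : @gumbel_cdf R x @[x --> +oo] --> expR 0 by rewrite expR0.
have h : - expR (- (x + euler_gamma R)) @[x --> +oo] --> (0 : R).
  by have := cvgN (cvgy_expRN_shift (euler_gamma R)); rewrite oppr0; apply.
exact: (cvg_comp (fun x => - expR (- (x + euler_gamma R))) expR h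
  (continuous_expR (x := 0))).
Qed.

Lemma cvgNy_gumbel_cdf {R : realType} : @gumbel_cdf R x @[x --> -oo] --> (0 : R).
Proof.
have h : expR (- (x + euler_gamma R)) @[x --> -oo] --> +oo.
  apply/cvgryPge => A; near=> x.
  apply: (@le_trans _ _ (1 - (x + euler_gamma R))); last exact: expR_ge1Dx.
  rewrite lerBrDr -lerBrDl -lerBrDr; near: x.
  by apply: nbhs_ninfty_le; rewrite num_real.
exact: (cvg_comp _ (fun x => expR (- x)) h (@cvgr_expR R)).
Unshelve. all: by end_near. Qed.

(** * Logit choice probabilities *)

(** [H] and [K] are the conditional expectations given the first two noises and given the first one,
    so three one-dimensional integrals suffice. *)
Lemma gumbelE3_iterated {R : realType} (F : R -> R -> R -> R) H K (c : R) :
  (forall x y, \int[lebesgue_measure]_z (gumbel_pdf z * F x y z)%:E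
    = (H x y)%:E)%E ->
  (forall x, \int[lebesgue_measure]_y (gumbel_pdf y * H x y)%:E
    = (K x)%:E)%E ->
  (\int[lebesgue_measure]_x (gumbel_pdf x * K x)%:E = c%:E)%E ->
  gumbelE3 F = c.
Proof.
move=> FH HK Kc; rewrite /gumbelE3 -[RHS]/(fine c%:E) -Kc; congr fine.
apply: eq_integral => x _; rewrite [RHS]EFinM -HK; congr (_ * _)%E.
by apply: eq_integral => y _; rewrite [RHS]EFinM -FH.
Qed.

Lemma gumbel_cdf_affine_primitive {R : realType} (B C c x : R) :
  is_derive x 1
    (fun y => B * gumbel_cdf y +
              C / (1 + expR c) * gumbel_cdf (y - ln (1 + expR c)))
    (gumbel_pdf x * (B + C * gumbel_cdf (x - c))).
Proof.
gumbel_derive_eq; rewrite mulrDr [in RHS]mulrCA gumbel_pdf_cdfM.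
by move: (gumbel_pdf _) (gumbel_pdf _) (gumbel_cdf _) (gumbel_cdf _) => *; ring.
Qed.

Lemma continuous_gumbel_affine {R : realType} (B C c : R) :
  continuous (fun x => gumbel_pdf x * (B + C * gumbel_cdf (x - c))).
Proof. gumbel_continuous. Qed.

Lemma cvgy_gumbel_cdf_affine {R : realType} (B C c : R) :
  B * gumbel_cdf x + C / (1 + expR c) * gumbel_cdf (x - ln (1 + expR c))
    @[x --> +oo] --> B * 1 + C / (1 + expR c) * 1.
Proof.
apply: cvgD; apply: cvgM; [exact: cvg_cst|exact: cvgy_gumbel_cdf|exact: cvg_cst|].
by apply: cvgy_subr; exact: cvgy_gumbel_cdf.
Qed.

Lemma cvgNy_gumbel_cdf_affine {R : realType} (B C c : R) :
  B * gumbel_cdf x + C / (1 + expR c) * gumbel_cdf (x - ln (1 + expR c))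
    @[x --> -oo] --> B * 0 + C / (1 + expR c) * 0.
Proof.
apply: cvgD; apply: cvgM; [exact: cvg_cst|exact: cvgNy_gumbel_cdf|exact: cvg_cst|].
by apply: cvgNy_subr; exact: cvgNy_gumbel_cdf.
Qed.

(** The shape shared by the inner integrands of the choice probabilities: constant up to a
    threshold, affine in a shifted cdf beyond it. When [C = 0], the shift [c] is immaterial and is
    taken to be 0. *)
Lemma integral_gumbel_cut {R : realType} (u : R -> R) (b A B C c : R) :
  (forall x, x <= b -> u x = A) ->
  (forall x, b < x -> u x = B + C * gumbel_cdf (x - c)) ->
  0 <= A -> (forall x, b <= x -> 0 <= B + C * gumbel_cdf (x - c)) ->
  (\int[lebesgue_measure]_x (gumbel_pdf x * u x)%:E)%E =
  (A * gumbel_cdf b + B * (1 - gumbel_cdf b) +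
   C / (1 + expR c) * (1 - gumbel_cdf (b - ln (1 + expR c))))%:E.
Proof.
move=> uA uB A0 B0.
have d1 (x : R) : is_derive x 1 (fun y => gumbel_cdf y * A) (gumbel_pdf x * A).
  by gumbel_derive_eq; rewrite mulr0 add0r mulrC.
have l1 : gumbel_cdf x * A @[x --> -oo] --> (0 : R).
  by have := cvgM (@cvgNy_gumbel_cdf R) (cvg_cst A); rewrite mul0r; apply.
rewrite (ge0_integral_cut (h := fun x => gumbel_pdf x * u x) (b := b) _ _ _ _ _ _
  d1 (gumbel_cdf_affine_primitive B C c) l1 (@cvgy_gumbel_cdf_affine _ B C c)).
- congr EFin; move: (gumbel_cdf _) (gumbel_cdf _) => *; ring.
- by move=> x xb; rewrite uA.
- by move=> x bx; rewrite uB.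
- by move=> x _; rewrite mulr_ge0// ltW// gumbel_pdf_gt0.
- by move=> x bx; rewrite mulr_ge0 ?B0// ltW// gumbel_pdf_gt0.
- by gumbel_continuous.
- exact: continuous_gumbel_affine.
Qed.

Lemma integral_gumbel_affine {R : realType} (B C c : R) :
  (forall x, 0 <= B + C * gumbel_cdf (x - c)) ->
  (\int[lebesgue_measure]_x (gumbel_pdf x * (B + C * gumbel_cdf (x - c)))%:E)%E =
  (B + C / (1 + expR c))%:E.
Proof.
move=> u0; pose h x := gumbel_pdf x * (B + C * gumbel_cdf (x - c)).
pose F y := B * gumbel_cdf y +
  C / (1 + expR c) * gumbel_cdf (y - ln (1 + expR c)).
have h0 x : 0 <= h x by rewrite mulr_ge0 ?u0// ltW// gumbel_pdf_gt0.
have dF := gumbel_cdf_affine_primitive B C c.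
have ch := @continuous_gumbel_affine _ B C c.
(* The cut at 0 is arbitrary: the two values of the primitive there cancel. *)
rewrite (ge0_integral_cut (h := h) (b := 0) _ _ _ _ ch ch dF dF
  (@cvgNy_gumbel_cdf_affine _ B C c) (@cvgy_gumbel_cdf_affine _ B C c))//.
- by congr EFin; rewrite -/(F 0); move: (F 0) => *; ring.
- by move=> x _; exact: h0.
- by move=> x _; exact: h0.
Qed.

Lemma addr_ln_expR {R : realType} (v1 v2 : R) :
  v1 + ln (1 + expR (v2 - v1)) = ln (expR v1 + expR v2).
Proof.
have S0 : 0 < 1 + expR (v2 - v1) by rewrite addr_gt0 ?expR_gt0.
rewrite -{1}[v1]expRK -lnM ?posrE ?expR_gt0//; congr ln.
by rewrite mulrDr mulr1 -expRD [v1 + _]addrC subrK.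
Qed.

Lemma choose_eq_None {R : realType} (u0 u1 u2 : R) :
  (Defs.choose u0 u1 u2 == None) = (u1 <= u0) && (u2 <= u0).
Proof. by rewrite /Defs.choose -ge_max; do 2?case: ifP. Qed.

Lemma choose_eq_fst {R : realType} (u0 u1 u2 : R) :
  (Defs.choose u0 u1 u2 == Some false) = (u0 < u1) && (u2 <= u1).
Proof.
rewrite /Defs.choose; have [u21|u12] := leP u2 u1.
  by rewrite ltNge; case: (u1 <= u0).
by rewrite andbF; case: ifP.
Qed.

Lemma choose_eq_snd {R : realType} (u0 u1 u2 : R) :
  (Defs.choose u0 u1 u2 == Some true) = (u0 < u2) && (u1 < u2).
Proof.
rewrite /Defs.choose; have [u21|u12] := leP u2 u1.
  by rewrite andbF; case: ifP.
by rewrite ltNge; case: (u2 <= u0).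
Qed.

(** Given [e0 = x], both items stay below [x] with probability
    [G (x - v1) * G (x - v2) = G (x - L)], where [G] is the cdf. Integrating over [x] gives
    [1 / (1 + expR L)]. *)
Lemma gumbelE3_choose_None {R : realType} (v1 v2 : R) :
  gumbelE3 (fun e0 e1 e2 =>
    if Defs.choose e0 (v1 + e1) (v2 + e2) == None then 1 else 0) =
  (1 + (expR v1 + expR v2))^-1.
Proof.
pose L := ln (expR v1 + expR v2).
have eL : expR L = expR v1 + expR v2 by rewrite lnK// posrE addr_gt0 ?expR_gt0.
apply: (@gumbelE3_iterated _ _
  (fun x y => if v1 + y <= x then gumbel_cdf (x - v2) else 0)
  (fun x => 0 + 1 * gumbel_cdf (x - L))).
- move=> x y; have [yx|xy] := leP (v1 + y) x; last first.
    by rewrite integral0_eq// => z _; rewrite choose_eq_None leNgt xy mulr0.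
  rewrite (@integral_gumbel_cut _ _ (x - v2) 1 0 0 0) ?mul0r ?mul1r ?addr0//.
  + by move=> z; rewrite lerBrDl choose_eq_None yx => ->.
  + by move=> z; rewrite ltrBlDl choose_eq_None yx leNgt => ->; rewrite mul0r addr0.
  + by move=> z _; rewrite mul0r addr0.
- move=> x; rewrite (@integral_gumbel_cut _ _ (x - v1) (gumbel_cdf (x - v2)) 0 0 0).
  + have := gumbel_cdfM v2 v1 x; rewrite [expR v2 + _]addrC -/L => ->.
    by rewrite !mul0r !addr0 add0r mul1r.
  + by move=> z; rewrite lerBrDl => ->.
  + by move=> z; rewrite ltrBlDl leNgt => ->/=; rewrite mul0r addr0.
  + by rewrite ltW// gumbel_cdf_gt0.
  + by move=> z _; rewrite mul0r addr0.
- rewrite integral_gumbel_affine ?eL ?add0r ?mul1r// => z.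
  by rewrite add0r mul1r ltW// gumbel_cdf_gt0.
Qed.

(** Here [k] is the probability that the first item beats the second. Integrating
    [G (y - (v2 - v1))] over [y > x - v1] leaves [k * (1 - G (x - L))]: which item is better is
    independent of how good the better one is. *)
Lemma gumbelE3_choose_fst {R : realType} (v1 v2 : R) :
  gumbelE3 (fun e0 e1 e2 =>
    if Defs.choose e0 (v1 + e1) (v2 + e2) == Some false then 1 else 0) =
  expR v1 / (1 + (expR v1 + expR v2)).
Proof.
pose L := ln (expR v1 + expR v2).
have eL : expR L = expR v1 + expR v2 by rewrite lnK// posrE addr_gt0 ?expR_gt0.
pose k := (1 + expR (v2 - v1))^-1.
have k0 : 0 <= k by rewrite invr_ge0 addr_ge0 ?expR_ge0.
apply: (@gumbelE3_iterated _ _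
  (fun x y => if v1 + y <= x then 0 else gumbel_cdf (y - (v2 - v1)))
  (fun x => k + - k * gumbel_cdf (x - L))).
- move=> x y; have [yx|xy] := leP (v1 + y) x.
    by rewrite integral0_eq// => z _; rewrite choose_eq_fst ltNge yx mulr0.
  rewrite (@integral_gumbel_cut _ _ (y - (v2 - v1)) 1 0 0 0) ?mul0r ?mul1r ?addr0//.
  + move=> z zy; rewrite choose_eq_fst xy ifT//=; lra.
  + move=> z zy; rewrite choose_eq_fst xy mul0r addr0 ifF//=.
    by apply/negbTE; rewrite -ltNge; lra.
  + by move=> z _; rewrite mul0r addr0.
- move=> x; rewrite (@integral_gumbel_cut _ _ (x - v1) 0 0 1 (v2 - v1)).
  + by rewrite !mul0r !add0r mul1r -/k -addrA -opprD addr_ln_expR mulrBr mulr1 mulNr.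
  + by move=> z; rewrite lerBrDl => ->.
  + by move=> z; rewrite ltrBlDl leNgt => ->/=; rewrite mul1r add0r.
  + by [].
  + by move=> z _; rewrite mul1r add0r ltW// gumbel_cdf_gt0.
- rewrite integral_gumbel_affine ?eL.
    congr EFin; rewrite /k expRB; field.
    by rewrite !gt_eqF ?addr_gt0 ?expR_gt0.
  move=> z; have := gumbel_cdf_le1 (z - L).
  move: (gumbel_cdf _) => ?; nra.
Qed.

(** The noise of the chosen item is integrated first, so the conditional probability is a tail
    beyond a maximum. The next integral splits where that maximum switches from [x] to [v1 + y]. *)
Lemma gumbelE3_choose_snd {R : realType} (v1 v2 : R) :
  gumbelE3 (fun e0 e1 e2 =>
    if Defs.choose e0 (v1 + e1) (v2 + e2) == Some true then 1 else 0) =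
  expR v2 / (1 + (expR v1 + expR v2)).
Proof.
pose L := ln (expR v1 + expR v2).
have eL : expR L = expR v1 + expR v2 by rewrite lnK// posrE addr_gt0 ?expR_gt0.
pose k := (1 + expR (v2 - v1))^-1.
have k0 : 0 <= 1 - k.
  by rewrite subr_ge0 invf_le1 ?addr_gt0 ?expR_gt0// lerDl expR_ge0.
apply: (@gumbelE3_iterated _ _
  (fun x y => 1 - gumbel_cdf (Num.max x (v1 + y) - v2))
  (fun x => (1 - k) + - (1 - k) * gumbel_cdf (x - L))).
- move=> x y.
  rewrite (@integral_gumbel_cut _ _ (Num.max x (v1 + y) - v2) 0 1 0 0)
    ?mul0r ?mul1r ?addr0 ?add0r//.
  + by move=> z; rewrite lerBrDl choose_eq_snd -gt_max ltNge => ->.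
  + by move=> z; rewrite ltrBlDl choose_eq_snd -gt_max => ->; rewrite mul0r addr0.
  + by move=> z _; rewrite mul0r addr0.
- move=> x; rewrite (@integral_gumbel_cut _ _ (x - v1) (1 - gumbel_cdf (x - v2))
    1 (-1) (v2 - v1)).
  + rewrite (_ : x - v1 - _ = x - L); last by rewrite /L -addr_ln_expR; ring.
    rewrite -/k; congr EFin.
    have := gumbel_cdfM v1 v2 x; rewrite -/L => <-.
    by move: (gumbel_cdf _) (gumbel_cdf _) => *; ring.
  + by move=> z; rewrite lerBrDl => /max_idPl ->.
  + move=> z; rewrite ltrBlDl => /ltW /max_idPr ->.
    by rewrite mulN1r opprB addrA [v1 + z]addrC.
  + by rewrite subr_ge0 gumbel_cdf_le1.
  + by move=> z _; rewrite mulN1r subr_ge0 gumbel_cdf_le1.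
- rewrite integral_gumbel_affine ?eL.
    congr EFin; rewrite /k expRB; field.
    by rewrite !gt_eqF ?addr_gt0 ?expR_gt0.
  move=> z; have := gumbel_cdf_le1 (z - L).
  move: (gumbel_cdf _) => ?; nra.
Qed.

(** * Expected maximal utility *)

(** Integration by parts; the leftover product of two cdfs is a single shifted cdf by
    [gumbel_cdfM]. *)
Lemma gumbel_pdf_primM_primitive {R : realType} (c x : R) :
  is_derive x 1 (fun y => gumbel_cdf y * gumbel_prim (y - c) -
      gumbel_prim (y - ln (1 + expR c)))
    (gumbel_pdf x * gumbel_prim (x - c)).
Proof.
gumbel_derive_eq.
have := gumbel_cdfM 0 c x; rewrite subr0 expR0 => ->.
by move: (gumbel_cdf _) (gumbel_prim _) (gumbel_pdf _) => *; ring.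
Qed.

(** The tail [1 - gumbel_cdf x] is at most [expR (- (x + gamma))], and [x <= 2 * expR (x / 2)]. *)
Lemma cvgy_idM_gumbel_ccdf {R : realType} :
  (gumbel_cdf x - 1) * x @[x --> +oo] --> (0 : R).
Proof.
pose g := euler_gamma R.
have half : (x / 2 : R) @[x --> +oo] --> +oo.
  by apply: gt0_cvgMly => //; exact: cvg_id.
have h : expR (- g) * (2 * expR (- (x / 2))) @[x --> +oo] --> (0 : R).
  have := cvgM (cvg_cst (expR (- g))) (cvgM (cvg_cst (2 : R))
    (cvg_comp _ (fun x => expR (- x)) half (@cvgr_expR R))).
  by rewrite !mulr0; apply.
have t0 : expR (- (x + g)) * x @[x --> +oo] --> (0 : R).
  apply: (squeeze_cvgr _ _ h); last exact: cvg_cst.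
  near=> x; have x0 : 0 < x by near: x; exact: nbhs_pinfty_gt.
  rewrite mulr_ge0 ?expR_ge0 ?(ltW x0)//= opprD expRD [_ * expR (- g)]mulrC.
  rewrite -mulrA ler_wpM2l ?expR_ge0// {1}[x]splitr opprD expRD.
  rewrite -mulrA [2 * _]mulrC ler_wpM2l ?expR_ge0//.
  rewrite expRN ler_pdivrMl ?expR_gt0// mulrC.
  have := expR_ge1Dx (x / 2); lra.
apply: (@squeeze_cvgr _ _ _ _ (fun x => - (expR (- (x + g)) * x)) (fun=> 0)).
- near=> x; have x0 : 0 < x by near: x; exact: nbhs_pinfty_gt.
  rewrite -mulNr; apply/andP; split; last first.
    by rewrite mulr_le0_ge0 ?(ltW x0)// subr_le0 gumbel_cdf_le1.
  rewrite ler_wpM2r ?(ltW x0)// lerBrDl.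
  exact: expR_ge1Dx.
- by have := cvgN t0; rewrite oppr0; apply.
- exact: cvg_cst.
Unshelve. all: by end_near. Qed.

Lemma cvgy_gumbel_cdf_primM {R : realType} (c : R) :
  gumbel_cdf x * gumbel_prim (x - c) - gumbel_prim (x - ln (1 + expR c))
    @[x --> +oo] --> ln (1 + expR c) - c.
Proof.
set d := ln _.
(* Each primitive is paired with its linear asymptote. The linear terms cancel up to
   [(gumbel_cdf x - 1) * x], which vanishes. *)
rewrite (_ : (fun x => _) = (fun x =>
   gumbel_cdf x * (gumbel_prim (x - c) - (x - c)) - (gumbel_prim (x - d) - (x - d))
   - gumbel_cdf x * c + ((gumbel_cdf x - 1) * x + d))); last first.
  apply/funext => x; move: (gumbel_cdf _) (gumbel_prim _) (gumbel_prim _) => *.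
  by ring.
rewrite (_ : d - c = 1 * 0 - 0 - 1 * c + (0 + d)); last by ring.
apply: cvgD; last by apply: cvgD; [exact: cvgy_idM_gumbel_ccdf|exact: cvg_cst].
apply: cvgB; last by apply: cvgM; [exact: cvgy_gumbel_cdf|exact: cvg_cst].
apply: cvgB; last exact: (cvgy_subr d (@cvgy_gumbel_prim R)).
by apply: cvgM; [exact: cvgy_gumbel_cdf|exact: (cvgy_subr c (@cvgy_gumbel_prim R))].
Qed.

Lemma integral_gumbel_pdf {R : realType} :
  (\int[lebesgue_measure]_x (@gumbel_pdf R x)%:E)%E = 1%:E.
Proof.
have := @integral_gumbel_affine R 1 0 0; rewrite mul0r addr0 => <-.
  by apply: eq_integral => x _; rewrite mul0r addr0 mulr1.
by move=> x; rewrite mul0r addr0.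
Qed.

Lemma gumbel_cdf_idM_primitive {R : realType} (b x : R) :
  is_derive x 1 (fun y => gumbel_cdf y * (y - b) - gumbel_prim y)
    (gumbel_pdf x * (x - b)).
Proof.
gumbel_derive_eq.
by move: (gumbel_cdf _) (gumbel_pdf _) => *; ring.
Qed.

(** The maximum may be negative, so it is written as [m] plus the positive part of [x - b], where
    [b = m - v]. The positive part has expectation [gumbel_prim b - b]. *)
Lemma integral_gumbel_maxr {R : realType} (m v : R) :
  (\int[lebesgue_measure]_x (gumbel_pdf x * Num.max m (v + x))%:E)%E =
  (v + gumbel_prim (m - v))%:E.
Proof.
pose b := m - v.
pose h x := if x <= b then 0 else gumbel_pdf x * (x - b).
have hl x : x <= b -> h x = 0 by rewrite /h => ->.
have hr x : b < x -> h x = gumbel_pdf x * (x - b) by rewrite /h leNgt => ->.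
have h2_ge0 x : b <= x -> 0 <= gumbel_pdf x * (x - b).
  by move=> bx; rewrite mulr_ge0 ?subr_ge0// ltW// gumbel_pdf_gt0.
have h_ge0 x : 0 <= h x.
  by rewrite /h; case: (leP x b) => // /ltW; exact: h2_ge0.
have c2 : continuous (fun x => gumbel_pdf x * (x - b)) by gumbel_continuous.
have d1 (x : R) : is_derive x 1 (fun=> 0 : R) 0 by exact: is_derive_cstf.
have l2 : gumbel_cdf x * (x - b) - gumbel_prim x @[x --> +oo] --> - b.
  rewrite (_ : (fun x => _) = (fun x => (gumbel_cdf x - 1) * x - gumbel_cdf x * b
      - (gumbel_prim x - x))); last first.
    by apply/funext => x; move: (gumbel_cdf _) (gumbel_prim _) => *; ring.
  rewrite (_ : - b = 0 - 1 * b - 0); last by ring.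
  apply: cvgB; last exact: cvgy_gumbel_prim.
  apply: cvgB; first exact: cvgy_idM_gumbel_ccdf.
  by apply: cvgM; [exact: cvgy_gumbel_cdf|exact: cvg_cst].
have c1 : continuous (fun _ : R => 0 : R) by exact: continuous_is_derive d1.
have l1 : (0 : R) @[_ --> (-oo : set_system R)] --> (0 : R) by exact: cvg_cst.
have hE := ge0_integral_cut hl hr (fun x _ => lexx 0) h2_ge0 c1 c2 d1
  (gumbel_cdf_idM_primitive b) l1 l2.
have mh := measurable_fun_cut hl hr c1 c2.
have ih := ge0_integrable mh h_ge0 hE.
have cpdf : continuous (@gumbel_pdf R).
  exact: continuous_is_derive (@is_derive_gumbel_pdf R).
have ipdf := ge0_integrable (continuous_measurable_fun cpdf)
  (fun x => ltW (gumbel_pdf_gt0 x)) (@integral_gumbel_pdf R).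
transitivity (\int[lebesgue_measure]_x (m%:E * (gumbel_pdf x)%:E + (h x)%:E))%E.
  apply: eq_integral => x _; rewrite -EFinM -EFinD; congr EFin.
  rewrite /h /b; have [xb|bx] := leP x (m - v).
    by rewrite max_l ?addr0 1?mulrC// addrC -lerBrDr.
  rewrite max_r; last by rewrite addrC -lerBlDr ltW.
  by move: (gumbel_pdf x) => *; ring.
rewrite integralD//; last exact: integrableZl.
rewrite integralZl// integral_gumbel_pdf hE -EFinM -EFinD; congr EFin.
by rewrite (subrr b) mulr0 /b; move: (gumbel_prim _) => *; ring.
Qed.


(** A second item of the same value acts as an increase of [v] by [ln 2]. The sign of [v] keeps the
    integrand nonnegative. *)
Lemma integral_gumbel_prim_maxr {R : realType} (e v : R) : 0 <= v ->
  (\int[lebesgue_measure]_x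
     (gumbel_pdf x * (v + gumbel_prim (Num.max e (v + x) - v)))%:E)%E =
  (v + ln 2 + gumbel_prim (e - (v + ln 2)))%:E.
Proof.
move=> v0; pose b := e - v; pose h1 x := gumbel_pdf x * (v + gumbel_prim b).
pose h2 x := gumbel_pdf x * (v + gumbel_prim x).
pose h x := gumbel_pdf x * (v + gumbel_prim (Num.max e (v + x) - v)).
have pdf_ge0 x : 0 <= @gumbel_pdf R x by rewrite ltW// gumbel_pdf_gt0.
have hl x : x <= b -> h x = h1 x.
  by rewrite /b lerBrDl /h => /max_idPl ->.
have hr x : b < x -> h x = h2 x.
  by rewrite /b ltrBlDl /h => /ltW/max_idPr ->; rewrite [v + x]addrC addrK.
have h1_ge0 x : 0 <= h1 x by rewrite mulr_ge0// addr_ge0// gumbel_prim_ge0.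
have h2_ge0 x : 0 <= h2 x by rewrite mulr_ge0// addr_ge0// gumbel_prim_ge0.
have c1 : continuous h1 by rewrite /h1; gumbel_continuous.
have c2 : continuous h2 by rewrite /h2; gumbel_continuous.
have d1 (x : R) : is_derive x 1 (fun y => gumbel_cdf y * (v + gumbel_prim b)) (h1 x).
  by gumbel_derive_eq; rewrite mulr0 add0r mulrC.
(* The two items have equal value, so the primitive is used with shift difference 0. *)
pose d := ln (1 + expR 0 : R).
have dE : d = ln 2 by rewrite /d expR0.
have d2 (x : R) : is_derive x 1
    (fun y => v * gumbel_cdf y + (gumbel_cdf y * gumbel_prim (y - 0) -
      gumbel_prim (y - d))) (h2 x).
  have dP := gumbel_pdf_primM_primitive 0 x; have dG := is_derive_gumbel_cdf x.
  derive_eq; rewrite /h2 subr0.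
  by move: (gumbel_prim _) (gumbel_pdf _) (gumbel_cdf _) => *; ring.
have l1 : gumbel_cdf x * (v + gumbel_prim b) @[x --> -oo] --> (0 : R).
  have := cvgM (@cvgNy_gumbel_cdf R) (cvg_cst (v + gumbel_prim b)).
  by rewrite mul0r; apply.
have l2 : v * gumbel_cdf x + (gumbel_cdf x * gumbel_prim (x - 0) -
    gumbel_prim (x - d)) @[x --> +oo] --> v * 1 + (d - 0).
  apply: cvgD; first by apply: cvgM; [exact: cvg_cst|exact: cvgy_gumbel_cdf].
  exact: cvgy_gumbel_cdf_primM.
rewrite (ge0_integral_cut hl hr (fun x _ => h1_ge0 x) (fun x _ => h2_ge0 x)
  c1 c2 d1 d2 l1 l2).
congr EFin; rewrite !subr0 dE /b (_ : e - (v + ln 2) = e - v - ln 2); last by ring.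
by move: (gumbel_cdf _) (gumbel_prim _) (gumbel_prim _) => *; ring.
Qed.

Lemma integral_gumbel_prim {R : realType} (w : R) : 0 <= w ->
  (\int[lebesgue_measure]_x (gumbel_pdf x * (w + gumbel_prim (x - w)))%:E)%E =
  (ln (1 + expR w))%:E.
Proof.
move=> w0; pose h x := gumbel_pdf x * (w + gumbel_prim (x - w)).
pose F y := w * gumbel_cdf y + (gumbel_cdf y * gumbel_prim (y - w) -
  gumbel_prim (y - ln (1 + expR w))).
have h_ge0 x : 0 <= h x.
  rewrite /h mulr_ge0//; first by rewrite ltW// gumbel_pdf_gt0.
  by rewrite addr_ge0// gumbel_prim_ge0.
have ch : continuous h by rewrite /h; gumbel_continuous.
have dF (x : R) : is_derive x 1 F (h x).
  have dP := gumbel_pdf_primM_primitive w x; have dG := is_derive_gumbel_cdf x.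
  rewrite /F; derive_eq; rewrite /h.
  by move: (gumbel_prim _) (gumbel_pdf _) (gumbel_cdf _) => *; ring.
have lN : F x @[x --> -oo] --> w * 0 + (0 * 0 - 0).
  apply: cvgD; first by apply: cvgM; [exact: cvg_cst|exact: cvgNy_gumbel_cdf].
  apply: cvgB; last exact: (cvgNy_subr _ cvgNy_gumbel_prim).
  by apply: cvgM; [exact: cvgNy_gumbel_cdf|exact: (cvgNy_subr _ cvgNy_gumbel_prim)].
have ly : F x @[x --> +oo] --> w * 1 + (ln (1 + expR w) - w).
  apply: cvgD; first by apply: cvgM; [exact: cvg_cst|exact: cvgy_gumbel_cdf].
  exact: cvgy_gumbel_cdf_primM.
rewrite (ge0_integral_cut (h := h) (b := 0) (fun x _ => erefl) (fun x _ => erefl)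
  (fun x _ => h_ge0 x) (fun x _ => h_ge0 x) ch ch dF dF lN ly).
by congr EFin; move: (F 0) => *; ring.
Qed.

(** The noises of the two items are integrated out first, leaving a single option of value
    [w = VP + ln 2] against the outside one, and [expR w = 2 * expR VP]. *)
Lemma exp_max_util_PP {R : realType} (VP VN : R) : 0 <= VP ->
  exp_max_util VP VN (true, true) = ln (1 + 2 * expR VP).
Proof.
move=> VP0; rewrite /exp_max_util /=.
have ln2_ge0 : 0 <= ln 2 :> R by rewrite ln_ge0// ler1n.
apply: (@gumbelE3_iterated _ _
  (fun x y => VP + gumbel_prim (Num.max x (VP + y) - VP))
  (fun x => VP + ln 2 + gumbel_prim (x - (VP + ln 2)))).
- move=> x y; under eq_integral do rewrite maxA.
  exact: integral_gumbel_maxr.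
- by move=> x; exact: integral_gumbel_prim_maxr.
- rewrite integral_gumbel_prim ?addr_ge0// expRD lnK ?posrE// mulrC//.
Qed.

Definition popular : action := (true, true).

Lemma choice_prob_popular {R : realType} (VP VN VN' : R) o :
  choice_prob VP VN popular o = choice_prob VP VN' popular o.
Proof. by rewrite /choice_prob. Qed.

Lemma choice_probE {R : realType} (VP VN : R) a o :
  choice_prob VP VN a o =
  (if o is Some s then expR (base_util VP VN (if s then a.2 else a.1)) else 1) /
  (1 + (expR (base_util VP VN a.1) + expR (base_util VP VN a.2))).
Proof.
case: o => [[|]|]; last by rewrite div1r; exact: gumbelE3_choose_None.
- exact: gumbelE3_choose_snd.
- exact: gumbelE3_choose_fst.
Qed.

Lemma choice_prob_ge0 {R : realType} (VP VN : R) a o : 0 <= choice_prob VP VN a o.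
Proof.
by rewrite choice_probE divr_ge0 ?addr_ge0 ?expR_ge0//; case: o => *; rewrite ?expR_ge0.
Qed.

Lemma sum_choice_prob {R : realType} (VP VN : R) a :
  \sum_(o : outcome) choice_prob VP VN a o = 1.
Proof.
rewrite (bigD1 None)//= (bigD1 (Some false))//= (bigD1 (Some true))//=.
by rewrite big1 => [|[[]|]//]; rewrite !choice_probE addr0 -!mulrDl divff.
Qed.

(* Keeps unification from comparing Gumbel integrals. *)
Local Opaque choice_prob.

(** * Policies and histories *)

(** Histories grow at their end, so the induction on time splits off the last entry. *)
Lemma sum_tuple_rcons {R : realType} (T : finType) t (F : seq T -> R) :
  \sum_(h : t.+1.-tuple T) F h = \sum_(h : t.-tuple T) \sum_(e : T) F (rcons h e).
Proof.
rewrite pair_big/= (reindex (fun p : t.-tuple T * T => [tuple of rcons p.1 p.2])) //=.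
exists (fun h : t.+1.-tuple T =>
  ([tuple of belast (thead h) (behead h)], last (thead h) (behead h))).
- move=> [h e] _; congr pair => /=.
    apply: val_inj => /=; case: h => [[|x s] hs] //=.
    by rewrite /thead (tnth_nth x)/= belast_rcons.
  case: h => [[|x s] hs] //=.
  by rewrite last_rcons.
- move=> h _; apply: val_inj => /=.
  by case/tupleP: h => x s /=; rewrite theadE -lastI.
Qed.

Lemma hist_prob_rcons {R : realType} (VP VN : R) (pol : policy R) h e :
  hist_prob VP VN pol (rcons h e) =
  hist_prob VP VN pol h * (pol h e.1 * choice_prob VP VN e.1 e.2).
Proof.
rewrite /hist_prob; move: (choice_prob VP VN) => cp.
rewrite size_rcons big_ord_recr/= -cats1 nth_cat ltnn subnn take_size_cat//=.
congr (_ * _); apply: eq_bigr => i _.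
by rewrite nth_cat ltn_ord take_cat ltn_ord.
Qed.

Lemma hist_prob_ge0 {R : realType} (VP VN : R) (pol : policy R) h :
  is_policy pol -> 0 <= hist_prob VP VN pol h.
Proof.
move=> [pol0 _]; apply: prodr_ge0 => i _.
by rewrite mulr_ge0// choice_prob_ge0.
Qed.

Lemma sum_entry_choice_prob {R : realType} (VP VN : R) (f : action -> R) :
  \sum_(e : entry) f e.1 * choice_prob VP VN e.1 e.2 = \sum_a f a.
Proof.
rewrite -(pair_big xpredT xpredT (fun a o => f a * choice_prob VP VN a o))/=.
by apply: eq_bigr => a _; rewrite -mulr_sumr sum_choice_prob mulr1.
Qed.

Lemma sum_hist_prob {R : realType} (VP VN : R) (pol : policy R) t :
  is_policy pol -> \sum_(h : t.-tuple entry) hist_prob VP VN pol h = 1.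
Proof.
move=> [_ pol1]; elim: t => [|t IH].
  rewrite (big_pred1 [tuple]) /hist_prob ?big_ord0// => h.
  by apply/esym/eqP; exact: tuple0.
rewrite sum_tuple_rcons -[RHS]IH; apply: eq_bigr => h _.
under eq_bigr do rewrite hist_prob_rcons.
by rewrite -mulr_sumr sum_entry_choice_prob pol1 mulr1.
Qed.

(** * The first deviation from popular items *)

Definition always_popular (h : seq entry) : bool :=
  all (fun e => e.1 == popular) h.

Definition popular_prob {R : realType} (VP VN : R) (pol : policy R) t : R :=
  \sum_(h : t.-tuple entry) hist_prob VP VN pol h * (always_popular h)%:R.

(** Concerns the action at time [t] alone, whatever was shown before. *)
Definition deviation_prob {R : realType} (VP VN : R) (pol : policy R) t : R :=
  \sum_(h : t.-tuple entry) hist_prob VP VN pol h * (1 - pol h popular).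

(** Histories with a niche item have weight 0, and on the others no factor depends on the niche
    utility. *)
Lemma popular_prob_VN {R : realType} (VP VN VN' : R) (pol : policy R) t :
  popular_prob VP VN pol t = popular_prob VP VN' pol t.
Proof.
apply: eq_bigr => h _; have [/allP hP|_] := boolP (always_popular h); last first.
  by move: (hist_prob _ _ _ _) (hist_prob _ _ _ _) => x y; rewrite !mulr0.
apply: (congr1 ( *%R ^~ _)); apply: eq_bigr => i _.
have /eqP -> := hP _ (mem_nth entry0 (ltn_ord i)).
by rewrite (choice_prob_popular VP VN VN').
Qed.

Lemma popular_prob0 {R : realType} (VP VN : R) (pol : policy R) :
  popular_prob VP VN pol 0 = 1.
Proof.
rewrite /popular_prob (big_pred1 [tuple]) /hist_prob ?big_ord0 ?mulr1// => h.
by apply/esym/eqP; exact: tuple0.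
Qed.

Lemma sum_pred1_mul {R : realType} (T : finType) (f : T -> R) (x : T) :
  \sum_y f y * (y == x)%:R = f x.
Proof.
rewrite (bigD1 x)//= eqxx mulr1 big1 ?addr0// => y /negbTE ->.
by rewrite mulr0.
Qed.

Lemma policy_le1 {R : realType} (pol : policy R) h a : is_policy pol -> pol h a <= 1.
Proof.
by move=> [pol0 pol1]; rewrite -(pol1 h) (bigD1 a)//= lerDl sumr_ge0.
Qed.

Lemma popular_probS {R : realType} (VP VN : R) (pol : policy R) t :
  popular_prob VP VN pol t.+1 = \sum_(h : t.-tuple entry)
    hist_prob VP VN pol h * (always_popular h)%:R * pol h popular.
Proof.
rewrite /popular_prob (@sum_tuple_rcons R _ _
  (fun h => hist_prob VP VN pol h * (always_popular h)%:R)).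
apply: eq_bigr => h _; rewrite -(sum_pred1_mul (pol h)).
rewrite -(sum_entry_choice_prob VP VN) mulr_sumr; apply: eq_bigr => e _.
by rewrite hist_prob_rcons /always_popular all_rcons -mulnb natrM; ring.
Qed.

Lemma popular_prob_le1 {R : realType} (VP VN : R) (pol : policy R) t :
  is_policy pol -> popular_prob VP VN pol t <= 1.
Proof.
move=> hpol; rewrite -(sum_hist_prob VP VN t hpol); apply: ler_sum => h _.
by rewrite ler_piMr ?hist_prob_ge0// lern1 leq_b1.
Qed.

(** A deviation at time [t] is one before time [t.+1]. This caps the gain from a high-utility
    user. *)
Lemma deviation_prob_le {R : realType} (VP VN : R) (pol : policy R) t :
  is_policy pol ->
  deviation_prob VP VN pol t <= 1 - popular_prob VP VN pol t.+1.
Proof.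
move=> hpol; rewrite -[X in X - _](sum_hist_prob VP VN t hpol) popular_probS -sumrB.
apply: ler_sum => h _; rewrite mulrBr mulr1 lerB// ler_wpM2r ?(proj1 hpol)//.
by rewrite ler_piMr ?hist_prob_ge0// lern1 leq_b1.
Qed.

(** A first deviation at time [t] is in particular a deviation then. This is the loss charged to a
    low-utility user. *)
Lemma deviation_prob_ge {R : realType} (VP VN : R) (pol : policy R) t :
  is_policy pol ->
  popular_prob VP VN pol t - popular_prob VP VN pol t.+1 <=
  deviation_prob VP VN pol t.
Proof.
move=> hpol; rewrite popular_probS -sumrB; apply: ler_sum => h _.
rewrite -[X in X - _]mulr1 -mulrBr ler_wpM2r ?subr_ge0 ?policy_le1//.
by rewrite ler_piMr ?hist_prob_ge0// lern1 leq_b1.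
Qed.

(** Averages a bound per action. The slope [k] may have either sign: 1 for a high-utility user,
    minus the gap for a low-utility one. *)
Lemma step_eng_le {R : realType} (VP VN q k : R) (pol : policy R) t :
  is_policy pol ->
  (forall a, 1 - choice_prob VP VN a None <= q + k * (a != popular)%:R) ->
  step_eng VP VN pol t <= q + k * deviation_prob VP VN pol t.
Proof.
move=> hpol hq; have [pol0 pol1] := hpol.
rewrite -[q]mulr1 -(sum_hist_prob VP VN t hpol) !mulr_sumr -big_split/=.
apply: ler_sum => h _; rewrite mulrCA [q * _]mulrC -mulrDr.
rewrite ler_wpM2l ?hist_prob_ge0//.
apply: (@le_trans _ _ (\sum_a pol h a * (q + k * (a != popular)%:R))).
  by apply: ler_sum => a _; rewrite ler_wpM2l.
rewrite -{2}(pol1 h) -(sum_pred1_mul (pol h)) -sumrB.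
rewrite [X in _ <= X + _](_ : q = \sum_a pol h a * q); last first.
  by rewrite -mulr_suml pol1 mul1r.
rewrite mulr_sumr -big_split/=; apply: ler_sum => a _.
by case: (a == popular); rewrite /= ?mulr1 ?mulr0; lra.
Qed.

Lemma step_eng_ge0 {R : realType} (VP VN : R) (pol : policy R) t :
  is_policy pol -> 0 <= step_eng VP VN pol t.
Proof.
move=> hpol; apply: sumr_ge0 => h _; rewrite mulr_ge0 ?hist_prob_ge0//.
apply: sumr_ge0 => a _; rewrite mulr_ge0 ?(proj1 hpol)// subr_ge0.
rewrite -(sum_choice_prob VP VN a) (bigD1 None)//= lerDl sumr_ge0// => o _.
exact: choice_prob_ge0.
Qed.

Lemma is_policy_APP {R : realType} : is_policy (@APP R).
Proof.
split=> [h a|h]; first by rewrite /APP; case: ifP.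
by rewrite /APP -big_mkcond/= big_pred1_eq.
Qed.

Lemma sum_APP {R : realType} (h : seq entry) (f : action -> R) :
  \sum_a @APP R h a * f a = f popular.
Proof.
rewrite -(sum_pred1_mul f); apply: eq_bigr => a _.
by rewrite mulrC /APP -/popular; case: eqP.
Qed.

Lemma step_eng_APP {R : realType} (VP VN : R) t :
  step_eng VP VN (@APP R) t = 1 - choice_prob VP VN popular None.
Proof.
rewrite /step_eng; under eq_bigr do rewrite sum_APP.
by rewrite -mulr_suml (sum_hist_prob _ _ _ is_policy_APP) mul1r.
Qed.

Lemma step_util_APP {R : realType} (VP VN : R) t :
  step_util VP VN (@APP R) t = exp_max_util VP VN popular.
Proof.
rewrite /step_util; under eq_bigr do rewrite sum_APP.
by rewrite -mulr_suml (sum_hist_prob _ _ _ is_policy_APP) mul1r.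
Qed.

(** * Discounting and the comparison with [APP] *)

Lemma summation_by_parts_discount {R : realType} (d : R) (B : nat -> R) n :
  B 0 = 0 ->
  \sum_(0 <= t < n) d ^+ t * (B t.+1 - B t) =
  (1 - d) * \sum_(0 <= t < n) d ^+ t * B t.+1 + d ^+ n * B n.
Proof.
move=> B0; elim: n => [|n IH]; first by rewrite !big_nil mulr0 B0 mulr0 addr0.
by rewrite !big_nat_recr//= IH exprS; ring.
Qed.

Lemma cvg_discounted_cst {R : realType} (d q : R) : 0 <= d < 1 ->
  \sum_(0 <= t < n) d ^+ t * q @[n --> \oo] --> (1 - d)^-1 * q.
Proof.
move=> /andP[d0 d1].
have := @cvg_geometric_series R q d; rewrite ger0_norm// => /(_ d1).
rewrite mulrC /series/=; apply: cvg_trans.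
by apply: near_eq_cvg; apply: nearW => n /=; apply: eq_bigr => t _; rewrite mulrC.
Qed.

Lemma engagement_PP {R : realType} (VP VN : R) :
  1 - choice_prob VP VN popular None = 2 * expR VP / (1 + 2 * expR VP).
Proof.
rewrite choice_probE /= -[expR VP + expR VP]mulr2n -[_ *+ 2]mulr_natl.
field; rewrite gt_eqF// addr_gt0// mulr_gt0// expR_gt0.
Qed.

(* The cost per period, against a low-utility user, of the best deviation,
   which shows one niche item. *)
Definition deviation_gap {R : realType} (VP : R) : R :=
  (1 + (expR VP + expR (-1)))^-1 - (1 + (expR VP + expR VP))^-1.

Lemma deviation_gap_gt0 {R : realType} (VP : R) : 0 <= VP -> 0 < deviation_gap VP.
Proof.
move=> VP0; rewrite subr_gt0 ltf_pV2 ?posrE ?addr_gt0 ?expR_gt0//.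
by rewrite !ltrD2l ltr_expR (lt_le_trans _ VP0)// ltrN10.
Qed.

(** One niche item costs exactly the gap. Two cost at least as much, since the niche weight is at
    most the popular one. *)
Lemma engagement_low {R : realType} (VP : R) a : 0 <= VP ->
  1 - choice_prob VP (-1) a None <= 1 - choice_prob VP (-1) popular None
    + - deviation_gap VP * (a != popular)%:R.
Proof.
move=> VP0; have e1 : expR (-1) <= expR VP.
  by rewrite ler_expR (le_trans _ VP0)// lerN10.
have S0 (x y : R) : 0 < 1 + (expR x + expR y) by rewrite !addr_gt0 ?expR_gt0.
rewrite !choice_probE /deviation_gap /=; case: a => [[|] [|]] /=;
  rewrite ?mulr0 ?mulr1 !div1r.
- by rewrite addr0.
- lra.
- by rewrite [expR (-1) + _]addrC; lra.
- have : (1 + (expR VP + expR (-1)))^-1 <= (1 + (expR (-1) + expR (-1)))^-1 :> R.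
    by rewrite lef_pV2 ?posrE// lerD2l lerD2r.
  lra.
Qed.

Lemma engagement_high {R : realType} (VP VN : R) a :
  1 - choice_prob VP VN a None <= 1 - choice_prob VP VN popular None
    + 1 * (a != popular)%:R.
Proof.
have [->|_] := eqVneq a popular; first by rewrite mulr0 addr0.
rewrite mulr1.
have c0 := choice_prob_ge0 VP VN a None.
have : choice_prob VP VN popular None <= 1.
  rewrite choice_probE div1r invf_le1 ?lerDl ?addr_gt0 ?addr_ge0 ?expR_gt0 ?expR_ge0//.
by move: (choice_prob _ _ _ _) (choice_prob _ _ _ _) c0 => *; lra.
Qed.

(** With [S] the sum of [delta ^+ t * B t.+1], the excess over [APP] is at most [p * S] minus
    [(1 - p) * c] times the discounted sum of increments of [B], and by parts that sum is at least
    [(1 - delta) * S]. *)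
Lemma partial_Eng_le {R : realType} (VP delta p : R) (pol : policy R) n :
  0 <= VP -> 0 <= delta -> 0 <= p < 1 -> is_policy pol ->
  p <= (1 - p) * (deviation_gap VP * (1 - delta)) ->
  \sum_(0 <= t < n) delta ^+ t * step_eng_p VP p pol t <=
  \sum_(0 <= t < n) delta ^+ t * (2 * expR VP / (1 + 2 * expR VP)).
Proof.
move=> VP0 d0 /andP[p0 p1] hpol ple.
set q := _ / _; set c := deviation_gap VP in ple *.
have c0 : 0 <= c by rewrite ltW// deviation_gap_gt0.
pose B t := 1 - popular_prob VP (-1) pol t.
have B_ge0 t : 0 <= B t by rewrite subr_ge0 popular_prob_le1.
have B0 : B 0 = 0 by rewrite /B popular_prob0 subrr.
have step t : step_eng_p VP p pol t <= q + (p * B t.+1 - (1 - p) * c * (B t.+1 - B t)).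
  have high := @step_eng_le _ VP ((1 - p) / p) q 1 pol t hpol.
  have low := @step_eng_le _ VP (-1) q (- c) pol t hpol.
  have dev1 := @deviation_prob_le _ VP ((1 - p) / p) pol t hpol.
  have dev2 := @deviation_prob_ge _ VP (-1) pol t hpol.
  (* The same [B] serves both user types. *)
  rewrite (popular_prob_VN _ _ (-1)) -/(B t.+1) in dev1.
  have {}dev2 : B t.+1 - B t <= deviation_prob VP (-1) pol t.
    have E (x y : R) : 1 - x - (1 - y) = y - x by ring.
    by rewrite /B E.
  have {}high : step_eng VP ((1 - p) / p) pol t <= q + B t.+1.
    apply: le_trans (high _) _; first by move=> a;
      rewrite /q -(engagement_PP VP ((1 - p) / p)); exact: engagement_high.
    by rewrite mul1r lerD2l.
  have {}low : step_eng VP (-1) pol t <= q - c * (B t.+1 - B t).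
    apply: le_trans (low _) _; first by move=> a;
      rewrite /q -(engagement_PP VP (-1)); exact: engagement_low.
    by rewrite mulNr lerD2l lerN2 ler_wpM2l.
  rewrite /step_eng_p.
  have hp := ler_wpM2l p0 high.
  have hp' := ler_wpM2l (_ : 0 <= 1 - p) low.
  rewrite subr_ge0 in hp'; have {}hp' := hp' (ltW p1).
  by apply: (le_trans (lerD hp hp')); rewrite le_eqVlt; apply/orP; left; apply/eqP; ring.
apply: (@le_trans _ _ (\sum_(0 <= t < n)
    (delta ^+ t * q + (p * (delta ^+ t * B t.+1) -
     (1 - p) * c * (delta ^+ t * (B t.+1 - B t)))))).
  apply: ler_sum => t _; apply: (le_trans (ler_wpM2l (exprn_ge0 t d0) (step t))).
  by rewrite le_eqVlt; apply/orP; left; apply/eqP; ring.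
rewrite big_split/= gerDl sumrB -!mulr_sumr summation_by_parts_discount//.
set S := \sum_(_ <= _ < _) _.
have S0 : 0 <= S by apply: sumr_ge0 => t _; rewrite mulr_ge0 ?exprn_ge0.
(* The boundary term of the summation by parts has the favourable sign and is dropped. *)
have E0 : 0 <= delta ^+ n * B n by rewrite mulr_ge0 ?exprn_ge0.
rewrite subr_le0 mulrDr.
apply: (@le_trans _ _ ((1 - p) * (c * (1 - delta)) * S)); first by rewrite ler_wpM2r.
have E1 : 0 <= (1 - p) * c * (delta ^+ n * B n).
  by rewrite mulr_ge0// mulr_ge0// subr_ge0 ltW.
by rewrite [(1 - p) * (c * _)]mulrA -[_ * (1 - delta) * S]mulrA lerDl.
Qed.

Theorem theorem1 (R : realType) (VP delta : R) :
  0 <= VP -> 0 <= delta < 1 ->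
  (exists p0 : R, 0 < p0 <= 1 /\
     forall p : R, 0 < p <= p0 -> p < 1 ->
       forall pol : policy R, is_policy pol ->
         Eng VP delta p pol <= Eng VP delta p (@APP R))
  /\
  (forall p : R, 0 < p < 1 ->
     Eng VP delta p (@APP R) =
       (1 - delta)^-1 * (2 * expR VP / (1 + 2 * expR VP)) /\
     Util VP delta p (@APP R) =
       (1 - delta)^-1 * ln (1 + 2 * expR VP)).
Proof.
move=> VP0 d01; have /andP[d0 d1] := d01.
set q := 2 * expR VP / _.
have EngAPP p : Eng VP delta p (@APP R) = (1 - delta)^-1 * q.
  apply/cvg_lim => //; rewrite /step_eng_p.
  under eq_fun do under eq_bigr do
    rewrite !step_eng_APP !engagement_PP -mulrDl addrC subrK mul1r.
  exact: cvg_discounted_cst.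
have UtilAPP p : Util VP delta p (@APP R) = (1 - delta)^-1 * ln (1 + 2 * expR VP).
  apply/cvg_lim => //; rewrite /step_util_p.
  under eq_fun do under eq_bigr do
    rewrite !step_util_APP !exp_max_util_PP// -mulrDl addrC subrK mul1r.
  exact: cvg_discounted_cst.
split; last by move=> p _; split.
pose k := deviation_gap VP * (1 - delta).
have k0 : 0 < k by rewrite mulr_gt0 ?deviation_gap_gt0// subr_gt0.
have k10 : 0 < 1 + k by rewrite addr_gt0.
(* The solution of [p = (1 - p) * k], which depends only on [VP] and [delta]. *)
exists (k / (1 + k)); split.
  by rewrite divr_gt0//= ler_pdivrMr// mul1r lerDr.
move=> p /andP[p0 pk] p1 pol hpol; rewrite EngAPP.
have ple : p <= (1 - p) * k by move: pk; rewrite ler_pdivlMr//; lra.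
pose S n := \sum_(0 <= t < n) delta ^+ t * step_eng_p VP p pol t.
pose T n := \sum_(0 <= t < n) delta ^+ t * q.
have T_cvg : T n @[n --> \oo] --> (1 - delta)^-1 * q by exact: cvg_discounted_cst.
have ST n : S n <= T n by apply: partial_Eng_le; rewrite // (ltW p0).
have q0 : 0 <= q by rewrite divr_ge0 ?addr_ge0 ?mulr_ge0 ?expR_ge0.
have T_le n : T n <= (1 - delta)^-1 * q.
  rewrite -(cvg_lim _ T_cvg)//; apply: nondecreasing_cvgn_le.
    apply/nondecreasing_seqP => m; rewrite /T big_nat_recr//= lerDl.
    by rewrite mulr_ge0 ?exprn_ge0.
  by apply/cvg_ex; exists ((1 - delta)^-1 * q).
(* [Eng] is a [limn], so the bound on partial sums passes to it only once they are known to
   converge: they increase and are bounded. *)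
have S_cvg : cvgn S.
  apply: nondecreasing_is_cvgn.
    apply/nondecreasing_seqP => m; rewrite /S big_nat_recr//= lerDl.
    rewrite mulr_ge0 ?exprn_ge0// addr_ge0// mulr_ge0 ?step_eng_ge0 ?ltW//.
    by rewrite subr_gt0.
  by exists ((1 - delta)^-1 * q) => _ [n _ <-]; exact: le_trans (ST n) (T_le n).
by apply: limr_le => //; apply: nearW => n; exact: le_trans (ST n) (T_le n).
Qed.
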